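(* Let $\epsilon\in(0,1)$, let $\ell\ge 1$ be an integer, and let $a=2\log(4\ell^2/\epsilon)+1$. For each $n$ let $T_n$ be a uniform random recursive tree on $n$ vertices. If $\ell$ is so large that $$\ell\ge 64a^2\log(22a\ell^2/\epsilon),$$ then there exists a seed-finding algorithm that outputs a vertex set $H_n\subset\{1,\ldots,n\}$ with $|H_n|\ge \ell/(3a)$ such that $$\liminf_{n\to\infty}\mathbb{P}\left\{H_n\subset T_\ell\right\}\ge 1-\epsilon .$$
   Context: Uniform random recursive tree: $T_1$ is the single vertex $1$; for $i\ge 2$, $T_i$ is obtained from $T_{i-1}$ by joining vertex $i$ by an edge to a vertex of $T_{i-1}$ chosen uniformly at random from $\{1,\ldots,i-1\}$, independently of all previous choices. $T_\ell$ is the subtree of $T_n$ formed by the first $\ell$ vertices; it is identified with its vertex set, so $H_n\subset T_\ell$ means $H_n\subset\{1,\ldots,\ell\}$. Seed-finding algorithm: for each $n$ it observes $T_n$ with the vertex labels hidden (it may depend on $n$, $\ell$, $\epsilon$, but it is not given the structure of $T_\ell$) and outputs a set $H_n$ of vertices of the observed tree. Formally: let $\sigma$ be a uniformly random permutation of $\{1,\ldots,n\}$ independent of $T_n$; the algorithm is, for each $n$, a (possibly randomized, with independent randomness) map $A$ from trees on $\{1,\ldots,n\}$ to subsets of $\{1,\ldots,n\}$, applied to the relabeled tree $\sigma(T_n)$, and $H_n=\sigma^{-1}(A(\sigma(T_n)))$. *)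

(* Defs.v *)
From mathcomp Require Import all_boot all_order all_algebra fingroup perm.
From mathcomp Require Import all_classical all_reals all_analysis.

Set Implicit Arguments.
Unset Strict Implicit.
Unset Printing Implicit Defensive.

Import Order.TTheory GRing.Theory Num.Theory.
Local Open Scope ring_scope.

(* Vertices 1, ..., n are represented by 'I_n: the ordinal with value i is the
   vertex i + 1. *)

Section Trees.
Variable n : nat.
Implicit Types (e : rel 'I_n) (s : {perm 'I_n}).

(* Length at most n suffices because the vertices of a cycle are distinct. *)
Definition acyclic e : bool :=
  [forall k : 'I_n.+1, forall c : k.-tuple 'I_n,
     (2 < k)%N && uniq c ==> ~~ path.cycle e c].

Definition is_tree e : bool :=
  [&& [forall x, forall y, e x y == e y x],
      [forall x, ~~ e x x],
      [forall x, forall y, connect e x y] &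
      acyclic e].

Record ltree := LTree {
  adj : {ffun 'I_n * 'I_n -> bool};
  adj_is_tree : is_tree (fun x y => adj (x, y)) }.

Definition relabel_adj s (t : ltree) : {ffun 'I_n * 'I_n -> bool} :=
  [ffun xy => adj t ((s^-1)%g xy.1, (s^-1)%g xy.2)].

Lemma relabel_is_tree s t : is_tree (fun x y => relabel_adj s t (x, y)).
Proof.
case: t => E treeE; case/and4P: (treeE); set e := fun x y => E (x, y).
move=> symE irrE conE acyE.
set e' := fun x y => _.
have e'E x y : e' x y = e ((s^-1)%g x) ((s^-1)%g y) by rewrite /e' ffunE.
apply/and4P; split.
- by apply/forallP => x; apply/forallP => y; rewrite !e'E; exact: (forallP (forallP symE _)).
- by apply/forallP => x; rewrite e'E; exact: (forallP irrE).
- apply/forallP => x; apply/forallP => y.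
  have /connectP[p ep yE] :=
    forallP (forallP conE ((s^-1)%g x)) ((s^-1)%g y).
  apply/connectP; exists (map s p).
  + rewrite -[x](permKV s); apply: homo_path ep => u v euv.
    by rewrite e'E !permK.
  + by rewrite -[x in last x](permKV s) last_map -yE permKV.
- apply/forallP => k; apply/forallP => c; apply/implyP => /andP[k2 uc].
  apply/negP => cyc.
  have /forallP/(_ (map_tuple (s^-1)%g c))/implyP := forallP acyE k.
  rewrite k2 map_inj_uniq ?uc; last exact: perm_inj.
  move=> /(_ isT)/negP; apply; rewrite cycle_map.
  by move: cyc; rewrite (@eq_cycle _ e' _ e'E).
Qed.

Definition relabel s (t : ltree) : ltree := LTree (relabel_is_tree s t).

(* p i is the vertex to which the vertex with ordinal value i + 1 is attached;
   it ranges over the i + 1 earlier vertices. *)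
Definition attachments := {dffun forall i : 'I_n.-1, 'I_i.+1}.

Definition attached (p : attachments) (x y : 'I_n) : bool :=
  [exists i : 'I_n.-1, (x == i.+1 :> nat) && (y == p i :> nat)].

Definition rec_adj (p : attachments) : {ffun 'I_n * 'I_n -> bool} :=
  [ffun xy => attached p xy.1 xy.2 || attached p xy.2 xy.1].

Lemma attached_lt p x y : attached p x y -> (y < x)%N.
Proof. by case/existsP=> i /andP[/eqP-> /eqP->]. Qed.

Lemma attached_inj p x y z : attached p x y -> attached p x z -> y = z.
Proof.
case/existsP=> i /andP[/eqP xi /eqP yi] /existsP[j /andP[/eqP xj /eqP zj]].
have ij : i = j by apply: val_inj; apply: succn_inj; rewrite /= -xi -xj.
by apply: val_inj; rewrite /= yi zj ij.
Qed.

Lemma rec_is_tree p : is_tree (fun x y => rec_adj p (x, y)).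
Proof.
set e := fun x y => _.
have eE x y : e x y = attached p x y || attached p y x by rewrite /e ffunE.
have esym : symmetric e by move=> x y; rewrite !eE orbC.
have down x y : e x y -> (y <= x)%N -> attached p x y.
  by rewrite eE => /orP[//|/attached_lt xy] yx; rewrite ltnNge yx in xy.
apply/and4P; split.
- by apply/forallP => x; apply/forallP => y; rewrite esym.
- by apply/forallP => x; rewrite eE orbb; apply/negP=> /attached_lt; rewrite ltnn.
- have con0 (m : nat) (x z : 'I_n) : x = m :> nat -> z = 0%N :> nat ->
    connect e x z.
    elim/ltn_ind: m x => -[|m] IH x xm z0.
      by rewrite (_ : x = z) ?connect0//; apply: val_inj; rewrite /= xm z0.
    have mn : (m < n.-1)%N by move: (ltn_ord x); rewrite xm; case: (n).
    pose i := Ordinal mn.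
    have pn : (p i < n)%N.
      by apply: leq_ltn_trans (ltn_ord x); rewrite xm ltnW// ltn_ord.
    apply: (@connect_trans _ _ (Ordinal pn)); last exact: (IH (p i)).
    apply: connect1; rewrite eE; apply/orP; left.
    by apply/existsP; exists i; rewrite xm !eqxx.
  apply/forallP => x; apply/forallP => y.
  have n0 : (0 < n)%N by apply: leq_ltn_trans (ltn_ord x).
  apply: (@connect_trans _ _ (Ordinal n0)); first exact: con0.
  by rewrite sym_connect_sym//; exact: con0.
- apply/forallP => k; apply/forallP => c; apply/implyP => /andP[k2 uc].
  apply/negP => cyc.
  have sc : size c = k by exact: size_tuple.
  have [x0 x0c] : exists x, x \in tval c.
    have: (0 < size c)%N by rewrite sc ltnW// ltnW.
    by case: (tval c) => [|x s _]; rewrite ?ltnn//; exists x; rewrite mem_head.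
  have [x xc xmax] := @arg_maxnP _ x0 [in tval c] (@nat_of_ord n) x0c.
  have [j c' rotE] := rot_to xc.
  move: cyc uc; rewrite -(rot_cycle j) -(rot_uniq j) rotE.
  have : size (rot j c) = k by rewrite size_rot.
  have {}xmax y : y \in rot j c -> (y <= x)%N by rewrite mem_rot; exact: xmax.
  rewrite rotE in xmax *.
  case: c' {rotE} xmax => [|y [|z c']] xmax /= sk; try by rewrite -sk in k2.
  rewrite rcons_path => /and3P[exy _ /andP[_ elx]] /and3P[_ yzc _].
  have yx := down _ _ exy (xmax y _).
  have lc : last z c' \in z :: c' by exact: mem_last.
  have lx : attached p x (last z c').
    apply: down; first by rewrite esym.
    by apply: xmax; rewrite !inE -in_cons lc !orbT.
  by move: yzc; rewrite (attached_inj (yx _) lx) ?lc// !inE eqxx orbT.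
Qed.

Definition rec_tree (p : attachments) : ltree := LTree (rec_is_tree p).

Definition first_vertices (l : nat) : {set 'I_n} := [set i : 'I_n | (i < l)%N].

End Trees.

Section Laws.
Variable R : realType.

Record fdist (T : finType) := FDist {
  pmf :> T -> R;
  pmf_ge0 : forall x, 0 <= pmf x;
  pmf_sum1 : \sum_x pmf x = 1 }.

Definition Pr (T : finType) (mu : fdist T) (E : pred T) : R :=
  \sum_(x | E x) mu x.

(* The attachments are independent, the one indexed by i being uniform over
   i + 1 vertices. *)
Definition attach_pmf n (p : attachments n) : R :=
  \prod_(i < n.-1) (#|'I_i.+1|%:R)^-1.

Lemma attach_pmf_ge0 n p : 0 <= @attach_pmf n p.
Proof. by apply: prodr_ge0 => i _; rewrite invr_ge0. Qed.

Lemma attach_pmf_sum1 n : \sum_p @attach_pmf n p = 1.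
Proof.
rewrite sumr_const card_dep_ffun -mulr_natl /attach_pmf.
rewrite foldrE big_map big_enum/=.
rewrite natr_prod -big_split/= big1// => i _.
by rewrite mulfV// pnatr_eq0 card_ord.
Qed.

Definition attach_law n : fdist (attachments n) :=
  FDist (@attach_pmf_ge0 n) (attach_pmf_sum1 n).

(* A randomized map is given by its kernel: A n t B is the probability that the
   output on the input tree t is B. *)
Definition seed_algorithm := forall n, ltree n -> fdist {set 'I_n}.

(* An outcome w = (p, s, B) consists of the attachments generating T_n, the hiding
   permutation, and the output of the algorithm on the relabelled tree. *)
Definition outcome n : finType := (attachments n * {perm 'I_n} * {set 'I_n})%type.

Definition seed_pmf (A : seed_algorithm) n (w : outcome n) : R :=
  attach_law n w.1.1 * (#|{perm 'I_n}|%:R)^-1 *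
  A n (relabel w.1.2 (rec_tree w.1.1)) w.2.

Lemma seed_pmf_ge0 A n w : 0 <= @seed_pmf A n w.
Proof. by rewrite !mulr_ge0 ?invr_ge0 ?pmf_ge0. Qed.

Lemma seed_pmf_sum1 A n : \sum_w @seed_pmf A n w = 1.
Proof.
rewrite -(pair_bigA _ (fun u B => seed_pmf A (u, B)))/= /seed_pmf/=.
under eq_bigr do rewrite -mulr_sumr pmf_sum1 mulr1.
rewrite -(pair_bigA _ (fun p (s : {perm 'I_n}) =>
  attach_law n p * (#|{perm 'I_n}|%:R)^-1))/=.
have perm_gt0 : (0 < #|{perm 'I_n}|)%N by apply/card_gt0P; exists 1%g.
under eq_bigr => p _.
  rewrite -mulr_sumr sumr_const -[X in _ * X]mulr_natl mulfV ?mulr1; last first.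
    by rewrite pnatr_eq0 -lt0n.
  over.
exact: (pmf_sum1 (attach_law n)).
Qed.

Definition seed_law (A : seed_algorithm) n : fdist (outcome n) :=
  FDist (@seed_pmf_ge0 A n) (seed_pmf_sum1 A n).

Definition seed_set n (w : outcome n) : {set 'I_n} := w.1.2 @^-1: w.2.

End Laws.

(* Main.v *)
(* Removing a vertex v from the tree leaves branches; v is central when its largest
   branch is small, and the algorithm returns the m most central vertices.

   Cut the tree into the N bags of vertices descending from 1, ..., N without
   passing through another of these.  If two bags have at least tau vertices, then
   every v <= N whose bag has at least tau vertices has no branch larger than
   n - tau: a branch avoids either the bag of v or the other large bag.  On the
   other hand, the branch of a vertex u > l containing the root has n - d vertices
   when u has d descendants (itself included).  Hence it suffices that at least m
   bags are heavy, i.e. of size at least tau, and that every vertex outside T_l has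
   fewer than tau descendants.

   Take tau about n L / l and N about l / L with L = log(4 l^2 / eps).  The bag sizes
   follow a Polya urn, so they are uniform over the compositions of n into N
   parts.  For the descendants of u this gives the tail (1 - tau / n)^(u - 1),
   whose sum over u > l is at most eps / 2.  The event that fewer than m bags are
   heavy is decreasing in the number of vertices, so its probability can be
   averaged over the trees on k <= n vertices.  It is then bounded by the number of
   bad compositions of sum at most n, divided by C(n, N), and a Chernoff bound with
   product weights 2^(-[w >= tau]) z^w, z = n / (n + N), makes it exponentially
   small in N. *)
Require Import Defs.
From mathcomp Require Import all_boot all_order all_algebra fingroup perm.
From mathcomp Require Import all_classical all_reals all_analysis.
From mathcomp Require Import zify ring lra.
Import Order.TTheory GRing.Theory Num.Theory.
Local Open Scope ring_scope.

Set Implicit Arguments.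
Unset Strict Implicit.
Unset Printing Implicit Defensive.

(** * Bags cut out by the first vertices *)

(* The first ancestor of x, possibly x itself, smaller than M when f is the parent
   map: then x iterations are enough. *)
Definition bag (M : nat) (f : nat -> nat) (x : nat) : nat :=
  iter x (fun y => if (y < M)%N then y else f y) x.

Lemma bag_fixed M f x : (x < M)%N -> bag M f x = x.
Proof. by move=> xM; rewrite /bag; elim: {1}x => //= k ->; rewrite xM. Qed.

(** Each step taken at or above [M] lowers the vertex, and vertices below [M] are fixed; so [x]
    steps reach the limit and further ones change nothing. *)
Lemma iter_bag M f x k : (forall y, (M <= y <= x)%N -> (f y < y)%N) ->
  (x <= k)%N -> (0 < M)%N ->
  iter k (fun y => if (y < M)%N then y else f y) x = bag M f x.
Proof.
move=> fP xk M0; set g := fun y => _.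
have fixg y j : (y < M)%N -> iter j g y = y.
  by move=> yM; elim: j => //= j ->; rewrite /g yM.
elim/ltn_ind: x k fP xk => x IH k fP xk.
have [xM|Mx] := ltnP x M; first by rewrite fixg// bag_fixed.
have fx : (f x < x)%N by apply: fP; rewrite Mx leqnn.
have fP' y : (M <= y <= f x)%N -> (f y < y)%N.
  by case/andP=> My yfx; apply: fP; rewrite My (leq_trans yfx (ltnW fx)).
case: k xk => [|k xk]; first by move: Mx fx; case: x {IH fP fP'}.
rewrite iterSr {2}/g ltnNge Mx /= IH//; last by rewrite -ltnS (leq_trans fx).
rewrite [RHS]/bag -/g; case: (x) fx Mx fP' IH => // x' fx Mx fP' IH.
by rewrite iterSr {2}/g ltnNge Mx/= IH.
Qed.

Lemma bag_parent M f x : (forall y, (M <= y <= x)%N -> (f y < y)%N) ->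
  (0 < M <= x)%N -> bag M f x = bag M f (f x).
Proof.
move=> fP /andP[M0 Mx].
have fx : (f x < x)%N by apply: fP; rewrite Mx leqnn.
rewrite {1}/bag; case: x fP Mx fx => // x fP Mx fx.
rewrite iterSr ltnNge Mx /= iter_bag// => y /andP[My yx].
by apply: fP; rewrite My (leq_trans yx (ltnW fx)).
Qed.

Lemma bag_lt M f x : (forall y, (M <= y <= x)%N -> (f y < y)%N) ->
  (0 < M)%N -> (bag M f x < M)%N.
Proof.
move=> + M0; elim/ltn_ind: x => x IH fP.
have [xM|Mx] := ltnP x M; first by rewrite bag_fixed.
have fx : (f x < x)%N by apply: fP; rewrite Mx leqnn.
rewrite bag_parent// ?M0//; apply: IH => // y /andP[My yx].
by apply: fP; rewrite My (leq_trans yx (ltnW fx)).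
Qed.

Lemma eq_bag M f g x : (forall y, (M <= y <= x)%N -> (f y < y)%N) ->
  (0 < M)%N -> (forall y, (y <= x)%N -> f y = g y) -> bag M f x = bag M g x.
Proof.
move=> + M0; elim/ltn_ind: x => x IH fP fg.
have [xM|Mx] := ltnP x M; first by rewrite !bag_fixed.
have fx : (f x < x)%N by apply: fP; rewrite Mx leqnn.
rewrite bag_parent// ?M0// [RHS]bag_parent ?M0// -?fg//; last first.
  by move=> y /andP[My yx]; rewrite -fg// fP// My.
apply: IH => // y => [/andP[My yx]|yx].
  by apply: fP; rewrite My (leq_trans yx (ltnW fx)).
by apply: fg; rewrite (leq_trans yx (ltnW fx)).
Qed.

(** Only the first [k] vertices are counted, so one sequence of attachments describes the bags at
    every stage of the growth. *)
Definition bag_size M (f : nat -> nat) k v : nat := \sum_(x < k) (bag M f x == v).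

Lemma bag_sizeS M f k v :
  bag_size M f k.+1 v = (bag_size M f k v + (bag M f k == v))%N.
Proof. by rewrite /bag_size big_ord_recr. Qed.

Lemma leq_bag_size M f v : {homo (bag_size M f)^~ v : j k / (j <= k)%N}.
Proof.
move=> j k /subnK <-; elim: (k - j)%N => // d IH; rewrite addSn bag_sizeS.
exact: leq_trans IH (leq_addr _ _).
Qed.

Lemma bag_size_base M f v : (v < M)%N -> bag_size M f M v = 1%N.
Proof.
move=> vM; rewrite /bag_size (bigD1 (Ordinal vM))//= bag_fixed// eqxx big1// => i.
by rewrite -val_eqE/= bag_fixed// => /negbTE->.
Qed.

Lemma bag_size_gt0 M f k v : (v < M)%N -> (M <= k)%N -> (0 < bag_size M f k v)%N.
Proof. by move=> vM Mk; rewrite -(@bag_size_base M f v vM) leq_bag_size. Qed.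

Lemma sum_bag_size M f k : (forall y, (M <= y < k)%N -> (f y < y)%N) ->
  (0 < M)%N -> \sum_(v < M) bag_size M f k v = k.
Proof.
move=> fP M0; rewrite /bag_size exchange_big/= (eq_bigr (fun=> 1%N)).
  by rewrite sum1_card card_ord.
move=> x _; have bl : (bag M f x < M)%N.
  apply: bag_lt => // y /andP[My yx]; apply: fP.
  by rewrite My (leq_ltn_trans yx).
rewrite (bigD1 (Ordinal bl))//= eqxx big1// => i.
by rewrite -val_eqE/= eq_sym => /negbTE->.
Qed.

Lemma bag_size_ub M f k v : (bag_size M f k v <= k)%N.
Proof.
by rewrite -{2}(card_ord k) -sum1_card leq_sum// => x _; case: (_ == _).
Qed.

(** * Branches of the recursive tree *)

(* The junk value is 0, at vertex 0 and outside the tree. *)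
Definition parent n (p : attachments n) (x : nat) : nat :=
  if insub x.-1 is Some i then nat_of_ord (p i) else 0.

Lemma parentE n (p : attachments n) (i : 'I_n.-1) : parent p i.+1 = p i.
Proof. by rewrite /parent succnK valK. Qed.

Lemma parent0 n (p : attachments n) : parent p 0 = 0%N.
Proof.
rewrite /parent; case: insubP => // k _ /= k0; apply/eqP.
by rewrite -leqn0 -ltnS (leq_trans (ltn_ord (p k)))// k0.
Qed.

Lemma parent_lt n (p : attachments n) x : (0 < x)%N -> (parent p x < x)%N.
Proof.
case: x => // x _; rewrite /parent succnK.
by case: insubP => //= i _ <-; exact: ltn_ord.
Qed.

Lemma bag_parent_lt n (p : attachments n) M x : (0 < M)%N -> (bag M (parent p) x < M)%N.
Proof.
move=> M0; apply: bag_lt => // y /andP[My _].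
exact: parent_lt (leq_trans M0 My).
Qed.

Lemma bag_of_parent n (p : attachments n) M x : (0 < M <= x)%N ->
  bag M (parent p) x = bag M (parent p) (parent p x).
Proof.
move=> /[dup] /andP[M0 _] Mx; apply: bag_parent => // y /andP[My _].
exact: parent_lt (leq_trans M0 My).
Qed.

Lemma attachedE n (p : attachments n) (x y : 'I_n) :
  attached p x y = (0 < x)%N && (parent p x == y).
Proof.
apply/existsP/andP => [[i /andP[/eqP-> /eqP->]]|[x0 /eqP pxy]].
  by rewrite parentE.
have xn : (x.-1 < n.-1)%N by move: x0 (ltn_ord x); case: (nat_of_ord x); case: (n).
have xE : x = (Ordinal xn).+1 :> nat by rewrite /= prednK.
by exists (Ordinal xn); rewrite -parentE -xE pxy !eqxx.
Qed.

Definition avoid n (t : ltree n) (v : 'I_n) : rel 'I_n :=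
  [rel x y | [&& adj t (x, y), x != v & y != v]].

Lemma avoidE n (t : ltree n) v x y :
  avoid t v x y = [&& adj t (x, y), x != v & y != v].
Proof. by []. Qed.

Definition branch n (t : ltree n) (v u : 'I_n) : {set 'I_n} :=
  [set w | connect (avoid t v) u w].

Definition max_branch n (t : ltree n) (v : 'I_n) : nat :=
  \max_(u | u != v) #|branch t v u|.

Lemma bag_size_card n (f : nat -> nat) M v :
  bag_size M f n v = #|[set x : 'I_n | bag M f x == v]|.
Proof.
by rewrite -sum1dep_card [RHS]big_mkcond; apply: eq_bigr => x _; case: (_ == _).
Qed.

Lemma adj_sym n (t : ltree n) x y : adj t (x, y) = adj t (y, x).
Proof. by case: t => E /= /and4P[/forallP/(_ x)/forallP/(_ y)/eqP]. Qed.

(** At threshold [u.+1] the bag of [u] is its set of descendants, itself included. Any other vertex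
    climbs through its parents to the root without meeting [u], hence lies in the branch of the
    root. *)
Lemma max_branch_outer n (p : attachments n) (u : 'I_n) : (0 < u)%N ->
  (n - bag_size u.+1 (parent p) n u <= max_branch (rec_tree p) u)%N.
Proof.
move=> u0; have n0 : (0 < n)%N by apply: leq_ltn_trans (ltn_ord u).
pose r := Ordinal n0; have ru : r != u by rewrite -val_eqE/= neq_ltn u0.
apply: leq_trans (leq_bigmax_cond (F := fun r => #|branch (rec_tree p) u r|) r ru).
rewrite bag_size_card -[X in (X - _)%N]card_ord leq_subLR.
set D := [set x | _]; rewrite -(cardsC D) leq_add2l subset_leq_card//.
apply/fintype.subsetP => w; rewrite !inE.
have sym : symmetric (avoid (rec_tree p) u).
  by move=> x y; rewrite !avoidE adj_sym [(_ != _) && _]andbC.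
rewrite sym_connect_sym//.
have [k] := ubnP (nat_of_ord w); elim: k w => // k IH w wk bw.
have [w0|w0] := posnP w.
  by rewrite (_ : w = r) ?connect0//; apply: val_inj.
have pw := parent_lt p w0.
pose w' := Ordinal (ltn_trans pw (ltn_ord w)).
have wu : w != u by apply: contraNneq bw => ->; rewrite bag_fixed.
have bw' : bag u.+1 (parent p) w' != u.
  have [uw|uw] := ltnP u w; first by rewrite /= -bag_of_parent.
  rewrite bag_fixed/=; last by rewrite ltnS (leq_trans (ltnW pw)).
  by rewrite neq_ltn (leq_trans pw).
apply: (@connect_trans _ _ w').
  apply: connect1; rewrite avoidE wu ffunE/= attachedE w0 eqxx/= -val_eqE /=.
  by apply: contraNneq bw' => /= ->; rewrite bag_fixed.
by apply: IH => //=; rewrite -ltnS (leq_trans _ wk).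
Qed.

(** An edge avoiding [v] joins either a vertex at or above [M] to its parent, which lies in the same
    bag, or two vertices below [M], neither of which is [v]. *)
Lemma avoid_bag n (p : attachments n) M (v x y : 'I_n) :
  (v < M)%N -> avoid (rec_tree p) v x y ->
  (bag M (parent p) x == v) = (bag M (parent p) y == v).
Proof.
move=> vM; wlog : x y / attached p x y => [WL|].
  move=> /[dup] xy; rewrite avoidE => /and3P[]; rewrite ffunE => /orP[] axy xv yv.
    exact: WL.
  by symmetry; apply: WL => //; rewrite avoidE adj_sym yv xv; move: xy => /and3P[->].
rewrite attachedE avoidE => /andP[x0 /eqP pxy] /and3P[_ xv yv].
have [xM|Mx] := ltnP x M; last first.
  by rewrite bag_of_parent ?pxy// (leq_ltn_trans _ vM).
rewrite !bag_fixed//; last by rewrite (ltn_trans _ xM)// -pxy parent_lt.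
by rewrite !val_eqE (negbTE xv) (negbTE yv).
Qed.

(** By [avoid_bag], a branch lies inside the bag of [v] or outside it. In the first case it misses
    the bag of [v'], in the second the bag of [v]. *)
Lemma max_branch_inner n (p : attachments n) M (v v' : 'I_n) (tau : nat) :
  (v < M)%N -> v' != v ->
  (tau <= bag_size M (parent p) n v)%N -> (tau <= bag_size M (parent p) n v')%N ->
  (max_branch (rec_tree p) v <= n - tau)%N.
Proof.
move=> vM v'v tv tv'; apply/bigmax_leqP => u uv.
pose D (v : nat) := [set x : 'I_n | bag M (parent p) x == v].
have subD : branch (rec_tree p) v u \subset
    [set w : 'I_n | (w \in D v) == (u \in D v)].
  apply/fintype.subsetP => w; rewrite !inE => /connectP[q].
  elim: q u {uv} => [|x q IH] u /=; first by move=> _ ->.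
  by move=> /andP[ux xq] wq; rewrite (avoid_bag vM ux); exact: IH.
apply: leq_trans (subset_leq_card subD) _.
have cC (A : {set 'I_n}) : #|~: A| = (n - #|A|)%N.
  by rewrite -[X in (X - _)%N](card_ord n) -(cardsC A) addKn.
rewrite !bag_size_card in tv tv'.
have [_|_] := boolP (u \in D v); last first.
  rewrite (_ : [set _ | _] = ~: D v) ?cC ?leq_sub2l//.
  by apply/setP => w; rewrite !inE eqbF_neg.
apply: leq_trans (leq_sub2l n tv'); rewrite -cC subset_leq_card//.
apply/fintype.subsetP => w; rewrite !inE eqb_id => /eqP ->.
by rewrite val_eqE eq_sym.
Qed.

(** * The algorithm *)

Definition most_central (m : nat) n (t : ltree n) : {set 'I_n} :=
  [set x in take m (sort (relpre (max_branch t) leq) (enum 'I_n))].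

Lemma card_most_central m n (t : ltree n) : (m <= n)%N -> #|most_central m t| = m.
Proof.
move=> mn; rewrite cardsE (card_uniqP _) ?size_take_min ?size_sort ?size_enum_ord.
  exact/minn_idPl.
by rewrite take_uniq// sort_uniq enum_uniq.
Qed.

(** If some [y] outside [Y] were selected, all of [Z] would precede it strictly and be selected too,
    making at least [m + 1] selected vertices. *)
Lemma most_central_sub m n (t : ltree n) (Z Y : {set 'I_n}) :
  (m <= #|Z|)%N ->
  (forall z y, z \in Z -> y \notin Y -> (max_branch t z < max_branch t y)%N) ->
  most_central m t \subset Y.
Proof.
move=> mZ ZY; apply/fintype.subsetP => y; apply: contraTT => yY.
apply/negP => yH; set r := relpre (max_branch t) leq.
have rtr : transitive r by move=> a b c; apply: leq_trans.
have : pairwise r (sort r (enum 'I_n)).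
  rewrite -sorted_pairwise//; apply: sort_sorted => a b; exact: leq_total.
rewrite -(cat_take_drop m (sort r _)) pairwise_cat => /andP[+ _].
move=> /allrelP rtd.
have ZH : y |: Z \subset most_central m t.
  rewrite finset.subUset finset.sub1set yH; apply/fintype.subsetP => z zZ; rewrite inE.
  have : z \in sort r (enum 'I_n) by rewrite mem_sort mem_enum.
  rewrite -{1}(cat_take_drop m (sort r _)) mem_cat => /orP[//|zd].
  have := rtd y z; rewrite inE in yH; move=> /(_ yH zd); rewrite /r /= leqNgt.
  by rewrite ZY.
have yZ : y \notin Z.
  by apply/negP => yZ; have := ZY y y yZ yY; rewrite ltnn.
have := subset_leq_card ZH; rewrite cardsU1 yZ add1n leqNgt ltnS => /negP; apply.
rewrite (leq_trans _ mZ)// cardsE (leq_trans (card_size _))// size_take_min.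
exact: geq_minl.
Qed.

Lemma branch_relabel n (s : {perm 'I_n}) (t : ltree n) v u :
  branch (relabel s t) (s v) (s u) = s @: branch t v u.
Proof.
apply/setP => w; rewrite -[w](permKV s) finset.mem_imset ?inE; last exact: perm_inj.
have e x y : avoid (relabel s t) (s v) (s x) (s y) = avoid t v x y.
  by rewrite !avoidE ffunE/= !permK !(inj_eq perm_inj).
set w' := (s^-1)%g w; apply/connectP/connectP => -[q].
  move=> + wq; rewrite -[q](mapK (permKV s)) => pq.
  exists (map (s^-1)%g q); last first.
    by apply: (@perm_inj _ s); rewrite -last_map -map_comp (eq_map (permKV s)) map_id.
  by move: pq; rewrite path_map; under eq_path do rewrite /= e.
move=> pq wq; exists (map s q); last by rewrite last_map wq.
by rewrite path_map; under eq_path do rewrite /= e.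
Qed.

Lemma max_branch_relabel n (s : {perm 'I_n}) (t : ltree n) v :
  max_branch (relabel s t) (s v) = max_branch t v.
Proof.
rewrite /max_branch (reindex_inj (@perm_inj _ s)); apply: eq_big => u.
  by rewrite (inj_eq perm_inj).
by move=> _; rewrite branch_relabel card_imset//; exact: perm_inj.
Qed.

(** Ties may be broken according to the observed labels, so the selection itself need not commute
    with relabelling. The strict separation of [Z] from the complement of [Y] does, as it involves
    [max_branch] alone. *)
Lemma most_central_relabel_sub m n (s : {perm 'I_n}) (t : ltree n) (Z Y : {set 'I_n}) :
  (m <= #|Z|)%N ->
  (forall z y, z \in Z -> y \notin Y -> (max_branch t z < max_branch t y)%N) ->
  s @^-1: most_central m (relabel s t) \subset Y.
Proof.
move=> mZ ZY; have si := @perm_inj _ s.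
suff /fintype.subsetP sub : most_central m (relabel s t) \subset s @: Y.
  by apply/fintype.subsetP => x; rewrite inE => /sub; rewrite finset.mem_imset.
apply: (@most_central_sub _ _ _ (s @: Z)); first by rewrite card_imset.
move=> z y /imsetP[z' z'Z ->]; rewrite -[y](permKV s) finset.mem_imset// => yY.
by rewrite !max_branch_relabel; exact: ZY.
Qed.

Section DiracAlgorithm.
Variables (R : realType) (m : nat).

Definition dirac_pmf (T : finType) (x y : T) : R := (y == x)%:R.

Lemma dirac_pmf_ge0 (T : finType) (x y : T) : 0 <= dirac_pmf x y.
Proof. exact: ler0n. Qed.

Lemma dirac_pmf_sum1 (T : finType) (x : T) : \sum_y dirac_pmf x y = 1.
Proof.
by rewrite /dirac_pmf (bigD1 x)//= eqxx big1 ?addr0// => y /negbTE ->.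
Qed.

Definition central_algorithm : seed_algorithm R := fun n t =>
  FDist (dirac_pmf_ge0 (most_central m t)) (dirac_pmf_sum1 (most_central m t)).

Lemma card_seed_set_central n (w : outcome n) : (m <= n)%N ->
  0 < seed_law central_algorithm n w -> #|seed_set w| = m.
Proof.
move=> mn; rewrite /= /seed_pmf/= /dirac_pmf; case: eqP => [wE _|_]; last first.
  by rewrite mulr0 ltxx.
rewrite /seed_set wE -[RHS](card_most_central (relabel w.1.2 (rec_tree w.1.1)) mn).
by rewrite card_preimset//; exact: perm_inj.
Qed.

(** A good attachment sequence succeeds under every relabelling, so the permutation and the output
    sum out to total mass 1. *)
Lemma Pr_central_algorithm n (Y : {set 'I_n}) (good : pred (attachments n)) :
  (forall p (s : {perm 'I_n}), good p ->
     s @^-1: most_central m (relabel s (rec_tree p)) \subset Y) ->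
  Pr (attach_law R n) good <=
  Pr (seed_law central_algorithm n) (fun w => seed_set w \subset Y).
Proof.
move=> goodY; set A := central_algorithm.
suff -> : Pr (attach_law R n) good = \sum_(w | good w.1.1) seed_pmf A w.
  rewrite /Pr [leRHS]big_mkcond [leLHS]big_mkcond; apply: ler_sum => w _.
  case: ifPn => gw; last by case: ifP => // _; exact: seed_pmf_ge0.
  case: ifPn => //= sw; rewrite /seed_pmf /= /dirac_pmf.
  case: eqP => [wE|_]; last by rewrite mulr0.
  by move: sw; rewrite /seed_set wE goodY.
rewrite [RHS]big_mkcond.
rewrite -(pair_bigA _ (fun u B => if good u.1 then seed_pmf A (u, B) else 0))/=.
rewrite /seed_pmf/=.
have sumB (u : attachments n * {perm 'I_n}) : \sum_B (if good u.1 then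
    attach_pmf R u.1 * (#|{perm 'I_n}|%:R)^-1 *
      dirac_pmf (most_central m (relabel u.2 (rec_tree u.1))) B else 0) =
    if good u.1 then attach_pmf R u.1 * (#|{perm 'I_n}|%:R)^-1 else 0.
  case: ifP => _; last by rewrite big1.
  by rewrite -mulr_sumr dirac_pmf_sum1 mulr1.
under eq_bigr do rewrite sumB.
rewrite -(pair_bigA _ (fun p (s : {perm 'I_n}) =>
  if good p then attach_pmf R p * (#|{perm 'I_n}|%:R)^-1 else 0))/=.
rewrite /Pr big_mkcond; apply: eq_bigr => p _; case: ifP => _; last by rewrite big1.
rewrite sumr_const -mulrnAr -[X in _ * X]mulr_natl mulfV ?mulr1//.
by rewrite pnatr_eq0 -lt0n; apply/card_gt0P; exists 1%g.
Qed.

End DiracAlgorithm.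

(** * Resampling an attachment *)

Section Expectation.
Variables (R : realType) (n : nat).
Implicit Types (F G : attachments n -> R) (p q : attachments n).

Definition expect F : R := \sum_p attach_law R n p * F p.

Lemma expectE F : expect F = (\prod_(i < n.-1) (#|'I_i.+1|%:R)^-1) * \sum_p F p.
Proof. by rewrite mulr_sumr. Qed.

Lemma eq_expect F G : F =1 G -> expect F = expect G.
Proof. by move=> FG; apply: eq_bigr => p _; rewrite FG. Qed.

Lemma le_expect F G : (forall p, F p <= G p) -> expect F <= expect G.
Proof. by move=> FG; apply: ler_sum => p _; apply: ler_wpM2l => //; exact: attach_pmf_ge0. Qed.

Lemma expect_ge0 F : (forall p, 0 <= F p) -> 0 <= expect F.
Proof. by move=> F0; apply: sumr_ge0 => p _; apply: mulr_ge0 => //; exact: attach_pmf_ge0. Qed.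

Lemma expect_sum (I : Type) (r : seq I) (P : pred I) (F : I -> attachments n -> R) :
  expect (fun p => \sum_(i <- r | P i) F i p) = \sum_(i <- r | P i) expect (F i).
Proof. by rewrite /expect; under eq_bigr do rewrite mulr_sumr; exact: exchange_big. Qed.

Lemma expectD F G : expect (fun p => F p + G p) = expect F + expect G.
Proof. by rewrite /expect -big_split; apply: eq_bigr => p _; rewrite mulrDr. Qed.

Lemma expectZ (c : R) F : expect (fun p => c * F p) = c * expect F.
Proof. by rewrite /expect mulr_sumr; apply: eq_bigr => p _; rewrite mulrCA. Qed.

Lemma expect_cst (c : R) : expect (fun=> c) = c.
Proof. by rewrite /expect -mulr_suml pmf_sum1 mul1r. Qed.

Lemma Pr_expect (A : pred (attachments n)) :
  Pr (attach_law R n) A = expect (fun p => (A p)%:R).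
Proof.
rewrite /Pr big_mkcond; apply: eq_bigr => p _.
by case: (A p); rewrite ?mulr1 ?mulr0.
Qed.

Definition reattach p (i : 'I_n.-1) (j : 'I_i.+1) : attachments n :=
  finfun (eqtype.dfwith p j).

Lemma reattach_in p (i : 'I_n.-1) (j : 'I_i.+1) : reattach p j i = j.
Proof. by rewrite ffunE dfwith_in. Qed.

Lemma reattach_out p (i : 'I_n.-1) (j : 'I_i.+1) k : i != k -> reattach p j k = p k.
Proof. by move=> ik; rewrite ffunE dfwith_out. Qed.

(* Swapping the current value p i with the new value j is an involution of the
   pairs (p, j). *)
Lemma sum_reattach (i : 'I_n.-1) F :
  \sum_p \sum_(j < i.+1) F (reattach p j) = i.+1%:R * \sum_p F p.
Proof.
pose h (x : attachments n * 'I_i.+1) := (reattach x.1 x.2, x.1 i).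
have hK : involutive h.
  case=> p j; rewrite /h /= reattach_in; congr pair; apply/ffunP => k.
  have [ik|ik] := eqVneq i k; last by rewrite !reattach_out.
  by case: k / ik; rewrite reattach_in.
rewrite (pair_bigA _ (fun p j => F (reattach p j)))/=.
rewrite -(reindex_inj (P := xpredT) (F := fun x => F x.1) (inv_inj hK)).
rewrite -(pair_bigA _ (fun p (_ : 'I_i.+1) => F p))/= mulr_sumr.
by apply: eq_bigr => p _; rewrite sumr_const card_ord mulr_natl.
Qed.

Lemma parent_reattach p (i : 'I_n.-1) (j : 'I_i.+1) x : (x <= i)%N ->
  parent (reattach p j) x = parent p x.
Proof.
case: x => [|x] xi; first by rewrite !parent0.
have xn : (x < n.-1)%N by rewrite (leq_trans xi)// ltnW.
rewrite -[x]/(val (Ordinal xn)) !parentE reattach_out//.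
by rewrite -val_eqE/= neq_ltn xi orbT.
Qed.

(** One step of the Polya urn: the parent of vertex [i.+1] is uniform over the earlier vertices, its
    bag is inherited, and [F] depends only on attachments that the resampling leaves alone. *)
Lemma expect_bag_next M (i : 'I_n.-1) (F : attachments n -> nat -> R) :
  (0 < M <= i.+1)%N ->
  (forall p q, (forall x, (x <= i)%N -> parent p x = parent q x) -> F p =1 F q) ->
  expect (fun p => F p (bag M (parent p) i.+1)) =
  expect (fun p => i.+1%:R^-1 * \sum_(j < i.+1) F p (bag M (parent p) j)).
Proof.
move=> /[dup] MM /andP[M0 Mi] FP; rewrite expectZ !expectE mulrCA; congr (_ * _).
have i0 : i.+1%:R != 0 :> R by rewrite pnatr_eq0.
apply: (mulfI i0); rewrite mulrA mulfV// mul1r.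
rewrite -sum_reattach; apply: eq_bigr => p _; apply: eq_bigr => j _.
rewrite (FP _ p) => [|x xi]; last exact: parent_reattach.
rewrite bag_of_parent// parentE reattach_in; congr (F p _).
have ji : (j <= i)%N by rewrite -ltnS ltn_ord.
apply: eq_bag => // y => [/andP[My _]|yj].
  exact: parent_lt (leq_trans M0 My).
by rewrite parent_reattach// (leq_trans yj).
Qed.

End Expectation.

(** * Descendants of a late vertex *)

Lemma eq_bag_size n M (p q : attachments n) k v : (0 < M)%N ->
  (forall x, (x < k)%N -> parent p x = parent q x) ->
  bag_size M (parent p) k v = bag_size M (parent q) k v.
Proof.
move=> M0 pq; apply: eq_bigr => x _; congr (nat_of_bool (_ == _)).
apply: eq_bag => // y => [/andP[My _]|yx]; first exact: parent_lt (leq_trans M0 My).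
by apply: pq; rewrite (leq_ltn_trans yx).
Qed.

(** Factor by factor, [(a - i) / (b - i) <= a / b]. *)
Lemma leq_bin_expn a b u : (a <= b)%N -> ('C(a, u) * b ^ u <= 'C(b, u) * a ^ u)%N.
Proof.
move=> ab; rewrite -(leq_pmul2r (fact_gt0 u)) mulnAC bin_ffact [leqRHS]mulnAC bin_ffact.
elim: u => [|u IH]; first by rewrite !ffactn0.
rewrite !ffactnSr !expnSr mulnACA [leqRHS]mulnACA leq_mul// !mulnBl.
by rewrite [(b * a)%N]mulnC leq_sub2l// leq_mul2l ab orbT.
Qed.

Lemma sum_expr_tail (R : realType) (q : R) l n : (l <= n)%N ->
  (1 - q) * \sum_(u < n | (l <= u)%N) q ^+ u = q ^+ l - q ^+ n.
Proof.
move=> ln; rewrite -(big_geq_mkord _ _ xpredT (fun u => q ^+ u)).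
rewrite mulr_sumr (eq_bigr (fun u => - q ^+ u.+1 - - q ^+ u)); last first.
  by move=> u _; rewrite exprS; ring.
by rewrite telescope_sumr// opprK addrC.
Qed.

Section Tail.
Variables (R : realType) (n : nat).

(** The bag size of [u] is distributed as one part of a uniform composition of [d + 1] into [u + 1]
    positive parts: ['C(d, u)] counts them all, ['C(d - K, u)] those whose chosen part exceeds [K].
    Induction on the number of vertices after [u]. *)
Lemma expect_bag_tail u d K : (0 < u <= d)%N -> (d < n)%N ->
  expect (fun p : attachments n => (K < bag_size u.+1 (parent p) d.+1 u)%:R : R) *
    'C(d, u)%:R <= 'C(d - K, u)%:R.
Proof.
move=> /andP[u0 /subnKC <-]; elim: (d - u)%N K => {d}[|d IH] K dn.
  rewrite addn0 binn mulr1 (eq_expect (G := fun=> (K == 0%N)%:R)) ?expect_cst.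
    by case: K => [|K]; rewrite ?subn0 ?binn.
  by move=> p; rewrite bag_size_base// ltnS leqn0.
rewrite addnS in dn *; set e := (u + d)%N in IH dn *; have en : (e < n.-1)%N by lia.
case: K => [|K].
  rewrite subn0 -[leRHS]mul1r ler_wpM2r//; rewrite -[leRHS](expect_cst n (1 : R)).
  by apply: le_expect => p; case: (_ < _)%N.
set S := fun p : attachments n => bag_size u.+1 (parent p) e.+1 u.
have [Ke|eK] := ltnP e K; last first.
  pose f K := expect (fun p : attachments n => (K < S p)%:R : R).
  (* The bag exceeds [K + 1] after the step when it did before, or when it had exactly [K + 1]
     vertices and received the new one, of conditional probability [(K + 1) / (e + 1)]. *)
  have rec : e.+1%:R * expect (fun p : attachments n =>
      (K.+1 < bag_size u.+1 (parent p) e.+2 u)%:R : R) =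
      (e - K)%:R * f K.+1 + K.+1%:R * f K.
    pose G (p : attachments n) x : R := (S p == K.+1)%:R * (x == u)%:R.
    have -> : expect (fun p : attachments n =>
        (K.+1 < bag_size u.+1 (parent p) e.+2 u)%:R : R) =
        f K.+1 + expect (fun p => G p (bag u.+1 (parent p) e.+1)).
      rewrite -expectD; apply: eq_expect => p; rewrite bag_sizeS -/(S p) /G.
      case: (_ == u); rewrite ?addn1 ?addn0 ?mulr1 ?mulr0 ?addr0// -natrD; congr _%:R.
      by case: ltngtP => // /eqP; lia.
    rewrite (expect_bag_next (i := Ordinal en) (F := G)); last 2 first.
    - by rewrite /= ltnS leq_addr.
    - by move=> p q pq x; rewrite /G /S (@eq_bag_size _ _ p q).
    rewrite expectZ mulrDr mulrA mulfV ?pnatr_eq0// mul1r.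
    have -> : expect (fun p => \sum_(j < e.+1) G p (bag u.+1 (parent p) j)) =
        K.+1%:R * (f K - f K.+1).
      rewrite -mulN1r -expectZ -expectD -expectZ; apply: eq_expect => p.
      rewrite -mulr_sumr -natr_sum -/(bag_size u.+1 (parent p) e.+1 u) -/(S p).
      by case: (ltngtP (S p) K.+1) => [_|_|->] /=; ring.
    by rewrite natrB// -natr1 -[K.+1%:R]natr1; ring.
  have eu : (0 < (e.+1 - u)%:R :> R) by rewrite ltr0n; lia.
  rewrite -(ler_pM2l eu) mulrCA -natrM -mul_bin_down succnK natrM mulrA [_ * e.+1%:R]mulrC rec.
  rewrite mulrDl -!mulrA.
  apply: (@le_trans _ _ ((e - K)%:R * 'C(e - K.+1, u)%:R + K.+1%:R * 'C(e - K, u)%:R)).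
    by apply: lerD; apply: ler_wpM2l => //; apply: IH; lia.
  rewrite subnS -!natrM mul_bin_down -natrD ler_nat -mulnDl subSS.
  (* Where the subtraction of [u] from [e - K] would truncate, the binomial coefficient vanishes. *)
  have [ue|ue] := leqP u (e - K); last by rewrite (bin_small ue) !muln0.
  by rewrite leq_mul2r; apply/orP; right; lia.
rewrite (eq_expect (G := fun=> 0)) ?expect_cst ?mul0r// => p.
by rewrite ltnNge (leq_trans (bag_size_ub _ _ _ _)).
Qed.

Lemma expect_bag_tail_pow u K : (0 < u < n)%N -> (K < n)%N ->
  expect (fun p : attachments n => (K < bag_size u.+1 (parent p) n u)%:R : R) <=
    ((n.-1 - K)%:R / n.-1%:R) ^+ u.
Proof.
move=> /andP[u0 un] Kn; have n1 : (0 < n.-1)%N by lia.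
have := @expect_bag_tail u n.-1 K; rewrite u0 prednK; last by lia.
have -> : (u <= n.-1)%N by lia.
move=> /(_ isT (leqnn _)) Ht.
have C0 : (0 < 'C(n.-1, u)%:R :> R) by rewrite ltr0n bin_gt0; lia.
rewrite -(ler_pM2r C0) (le_trans Ht)// expr_div_n mulrAC.
rewrite ler_pdivlMr ?exprn_gt0 ?ltr0n// -!natrX -!natrM ler_nat [leqRHS]mulnC.
by rewrite leq_bin_expn// leq_subr.
Qed.

(** Union bound over [u]: the tails are dominated by a geometric series of ratio [q], and [n.-1 / K]
    is [1 / (1 - q)]. *)
Lemma expect_exists_bag_tail l K : (0 < l)%N -> (0 < K < n)%N ->
  expect (fun p : attachments n =>
    [exists u : 'I_n, (l <= u)%N && (K < bag_size u.+1 (parent p) n u)%N]%:R : R) <=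
    ((n.-1 - K)%:R / n.-1%:R) ^+ l * (n.-1%:R / K%:R).
Proof.
move=> l0 /andP[K0 Kn]; set q := _ / _.
have n0 : (0 < n.-1%:R :> R) by rewrite ltr0n; lia.
have q1 : 1 - q = K%:R / n.-1%:R.
  by rewrite /q natrB; [field; rewrite gt_eqF|lia].
have q0 : 0 <= q by rewrite /q divr_ge0.
apply: (@le_trans _ _ (\sum_(u < n | (l <= u)%N) q ^+ u)).
  apply: (@le_trans _ _ (\sum_(u < n | (l <= u)%N)
    expect (fun p : attachments n => (K < bag_size u.+1 (parent p) n u)%:R : R))).
    rewrite -expect_sum; apply: le_expect => p; case: existsP => [[u /andP[lu Ku]]|_].
      by rewrite (bigD1 u)//= Ku lerDl sumr_ge0.
    exact: sumr_ge0.
  apply: ler_sum => u lu; apply: expect_bag_tail_pow => //.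
  by rewrite ltn_ord (leq_trans l0 lu).
have K0' : (0 < 1 - q) by rewrite q1 divr_gt0// ltr0n.
rewrite -invf_div -q1 ler_pdivlMr// mulrC.
have [ln|nl] := leqP l n; first by rewrite sum_expr_tail// lerBlDr lerDl exprn_ge0.
rewrite big1 ?mulr0 ?exprn_ge0// => u lu.
by have := ltn_trans (leq_ltn_trans lu (ltn_ord u)) nl; rewrite ltnn.
Qed.

End Tail.

(** * Heavy bags *)

Section Heavy.
Variables (R : realType) (n : nat).

(** There are ['C(d, M)] compositions of [d + 1] into [M + 1] positive parts, all equally likely. In
    the induction the last vertex joins bag [v] from the state lowered by one at [v], with
    probability [(w v - 1) / (e + 1)]; these numerators add up to [e + 1 - M]. *)
Lemma expect_bag_mass M d (w : nat -> nat) : (M <= d < n)%N ->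
  expect (fun p : attachments n =>
    [forall v : 'I_M.+1, bag_size M.+1 (parent p) d.+1 v == w v]%:R : R) *
    'C(d, M)%:R <= 1.
Proof.
case/andP => /subnKC <-; elim: (d - M)%N w => {d}[|d IH] w dn.
  rewrite addn0 binn mulr1 -[leRHS](expect_cst n (1 : R)).
  by apply: le_expect => p; case: [forall _, _].
rewrite addnS in dn *; set e := (M + d)%N in IH dn *; have en : (e < n.-1)%N by lia.
pose S (p : attachments n) : nat -> nat := bag_size M.+1 (parent p) e.+1.
pose S' (p : attachments n) : nat -> nat := bag_size M.+1 (parent p) e.+2.
rewrite -/S'.
(* Vectors that are not compositions of [e + 2] into positive parts are never attained. *)
have [/andP[/forallP wpos /eqP sumw]|wN] := boolP
    ([forall v : 'I_M.+1, (0 < w v)%N] && (\sum_(v < M.+1) w v == e.+2)%N); last first.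
  rewrite (eq_expect (G := fun=> 0)) ?expect_cst ?mul0r// => p.
  case: forallP => // Sw; case/negP: wN; apply/andP; split.
    apply/forallP => v; rewrite -(eqP (Sw v)).
    by apply: bag_size_gt0 => //; rewrite /e; lia.
  rewrite -(@sum_bag_size M.+1 (parent p) e.+2)//; last first.
    by move=> y /andP[My _]; exact: parent_lt (leq_trans _ My).
  by apply/eqP/esym; apply: eq_bigr => v _; exact/eqP.
pose dec (v x : nat) := if x == v then (w x).-1 else w x.
pose A (v : nat) (p : attachments n) : bool := [forall u : 'I_M.+1, S p u == dec v u].
pose G (p : attachments n) (x : nat) : R := \sum_(v < M.+1) (x == v)%:R * (A v p)%:R.
have S'G : expect (fun p : attachments n => [forall v : 'I_M.+1, S' p v == w v]%:R) <=
    expect (fun p => G p (bag M.+1 (parent p) e.+1)).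
  apply: le_expect => p; case: forallP => [Sw|_]; last first.
    by apply: sumr_ge0 => v _; rewrite mulr_ge0.
  have bM := bag_parent_lt p e.+1 (ltn0Sn M).
  rewrite /G (bigD1 (Ordinal bM))//= eqxx mul1r.
  have -> : A (bag M.+1 (parent p) e.+1) p.
    apply/forallP => u; rewrite /dec -(eqP (Sw u)) /S' bag_sizeS -/(S p) [nat_of_ord u == _]eq_sym.
    by case: (bag M.+1 (parent p) e.+1 == u); rewrite ?addn1 ?addn0.
  by rewrite lerDl sumr_ge0// => v _; rewrite mulr_ge0.
rewrite (expect_bag_next (i := Ordinal en)) in S'G; last 2 first.
- by rewrite /= ltnS leq_addr.
- move=> p q pq x; rewrite /G; apply: eq_bigr => v _; congr (_ * (nat_of_bool _)%:R).
  by apply: eq_forallb => u; rewrite /S (@eq_bag_size _ _ p q).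
rewrite /= expectZ in S'G.
have EG : expect (fun p => \sum_(j < e.+1) G p (bag M.+1 (parent p) j)) =
    \sum_(v < M.+1) (w v).-1%:R * expect (fun p => (A v p)%:R : R).
  rewrite (eq_expect (G := fun p => \sum_(v < M.+1) (w v).-1%:R * (A v p)%:R)).
    by rewrite expect_sum; apply: eq_bigr => v _; rewrite expectZ.
  move=> p; rewrite exchange_big; apply: eq_bigr => v _; rewrite -mulr_suml -natr_sum.
  rewrite -/(bag_size M.+1 (parent p) e.+1 v) -/(S p v).
  case: (boolP (A v p)) => [/forallP/(_ v)/eqP ->|_]; last by rewrite !mulr0.
  by rewrite /dec eqxx.
rewrite EG mulrC ler_pdivlMr ?ltr0n// in S'G.
have eM : (0 < (e.+1 - M)%:R :> R) by rewrite ltr0n /e; lia.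
rewrite -(ler_pM2l eM) mulrCA -natrM -mul_bin_down succnK natrM mulrA mulr1.
apply: (@le_trans _ _ ((\sum_(v < M.+1) (w v).-1%:R * expect (fun p => (A v p)%:R : R)) *
    'C(e, M)%:R)); first by rewrite ler_wpM2r.
rewrite mulr_suml (@le_trans _ _ (\sum_(v < M.+1) (w v).-1%:R))//.
  apply: ler_sum => v _; rewrite -[leRHS]mulr1 -mulrA; apply: ler_wpM2l => //.
  by apply: IH; lia.
rewrite -natr_sum ler_nat -(leq_add2r M.+1) -[X in (_ + X)%N](card_ord M.+1).
rewrite -sum1_card -big_split/= (eq_bigr (fun v : 'I_M.+1 => w v)) ?sumw.
  by rewrite /e; lia.
by move=> v _; rewrite addn1 prednK.
Qed.

Definition few_heavy M (m tau : nat) (w : nat -> nat) : bool :=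
  (#|[set v : 'I_M | (tau <= w v)%N]| < m)%N.

Lemma sum_bin M k : (\sum_(d < k) 'C(d, M) = 'C(k, M.+1))%N.
Proof. by elim: k => [|k IH]; rewrite ?big_ord0// big_ord_recr/= IH binS. Qed.

(** Bags only grow, so having few heavy bags at time [n] forces it at each earlier time [d + 1].
    Summing with weights ['C(d, M)], of total ['C(n, M.+1)], and bounding each point mass by
    [expect_bag_mass] leaves a count of bad compositions. *)
Lemma expect_few_heavy M m tau : (M < n)%N ->
  expect (fun p : attachments n =>
      (few_heavy M.+1 m tau (bag_size M.+1 (parent p) n))%:R : R) * 'C(n, M.+1)%:R <=
  \sum_(w : {ffun 'I_M.+1 -> 'I_n.+1})
    [&& few_heavy M.+1 m tau (fun v => if insub v is Some v' then w v' else 0%N),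
        [forall v, (0 < w v)%N] & (\sum_v w v <= n)%N]%:R.
Proof.
move=> Mn; set bad := few_heavy M.+1 m tau.
pose ext (w : {ffun 'I_M.+1 -> 'I_n.+1}) v :=
  if insub v is Some v' then w v' : nat else 0%N.
have extE w (v : 'I_M.+1) : ext w v = w v by rewrite /ext valK.
rewrite -sum_bin natr_sum mulr_sumr.
apply: (@le_trans _ _ (\sum_(d < n) \sum_(w : {ffun 'I_M.+1 -> 'I_n.+1})
   [&& bad (ext w), [forall v, (0 < w v)%N] & (\sum_v w v == d.+1)%N]%:R)).
  apply: ler_sum => d _; have [dM|Md] := ltnP d M.
    by rewrite bin_small// mulr0 sumr_ge0.
  apply: (@le_trans _ _ (\sum_(w : {ffun 'I_M.+1 -> 'I_n.+1})
      expect (fun p : attachments n =>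
         [&& bad (ext w), [forall v, (0 < w v)%N] & (\sum_v w v == d.+1)%N]%:R *
        ([forall v : 'I_M.+1, bag_size M.+1 (parent p) d.+1 v == ext w v]%:R : R))
      * 'C(d, M)%:R)); last first.
    apply: ler_sum => w _; rewrite expectZ -mulrA -[leRHS]mulr1; apply: ler_wpM2l => //.
    by apply: expect_bag_mass; rewrite Md ltn_ord.
  rewrite -mulr_suml -expect_sum; apply: ler_wpM2r => //; apply: le_expect => p.
  have [bp|//] := boolP (bad _); last by rewrite sumr_ge0// => w _; rewrite mulr_ge0.
  have Sn v : (bag_size M.+1 (parent p) d.+1 v < n.+1)%N.
    by rewrite ltnS (leq_trans (bag_size_ub _ _ _ _)).
  pose w0 : {ffun 'I_M.+1 -> 'I_n.+1} := [ffun v : 'I_M.+1 => Ordinal (Sn v)].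
  have w0E (v : 'I_M.+1) : ext w0 v = bag_size M.+1 (parent p) d.+1 v.
    by rewrite extE ffunE.
  rewrite (bigD1 w0)//= -[leLHS]addr0 lerD//; last first.
    by rewrite sumr_ge0// => w _; rewrite mulr_ge0.
  have -> : [forall v : 'I_M.+1, bag_size M.+1 (parent p) d.+1 v == ext w0 v].
    by apply/forallP => v; rewrite w0E.
  have -> : bad (ext w0).
    apply: leq_ltn_trans bp; apply: subset_leq_card; apply/fintype.subsetP => v.
    by rewrite !inE w0E => /leq_trans; apply; exact: leq_bag_size.
  have -> : [forall v, (0 < w0 v)%N].
    by apply/forallP => v; rewrite -extE w0E; exact: bag_size_gt0.
  rewrite mulr1 (eq_bigr (fun v : 'I_M.+1 => bag_size M.+1 (parent p) d.+1 v)).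
    rewrite sum_bag_size ?eqxx// => y /andP[My _].
    exact: parent_lt (leq_trans _ My).
  by move=> v _; rewrite -extE w0E.
rewrite exchange_big; apply: ler_sum => w _.
case: (boolP (bad _)) => _ /=; last by rewrite big1.
case: (boolP [forall _, _]) => _ /=; last by rewrite big1.
(* A given [w] contributes for one time at most, namely [d + 1 = s]. *)
set s := (\sum_v w v)%N; case: (leqP s n) => sn; last first.
  by rewrite big1// => d _; case: eqP => // sd; move: sn; rewrite sd ltnNge ltn_ord.
case: s sn => [|s] sn; first by rewrite big1.
rewrite (bigD1 (Ordinal sn))//= eqxx big1 ?addr0// => d.
by rewrite -val_eqE/= eqSS eq_sym => /negbTE ->.
Qed.

(** Chernoff bound: a bad composition has at most [m] heavy parts and sum at most [n], so its
    product weight is at least [z ^+ n / 2 ^+ m]; the total weight of all vectors factorises over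
    the parts. *)
Lemma few_heavy_bound M m tau (z : R) : (M < n)%N -> (tau <= n)%N -> 0 < z < 1 ->
  expect (fun p : attachments n =>
      (few_heavy M.+1 m tau (bag_size M.+1 (parent p) n))%:R : R) *
    ('C(n, M.+1)%:R * z ^+ n * (1 - z) ^+ M.+1) <=
  2 ^+ m * (1 - z ^+ tau / 2) ^+ M.+1.
Proof.
move=> Mn tn /andP[z0 z1]; have zle := ltW z1; have zge := ltW z0.
have z1' : 0 < 1 - z by rewrite subr_gt0.
rewrite !mulrA; have := @expect_few_heavy M m tau Mn; set P := expect _ * _ => PE.
(* The weight is zero at [j = 0] because every bag is nonempty; a heavy part costs a factor
   [1 / 2]. *)
pose g (j : 'I_n.+1) : R := (0 < j)%N%:R * z ^+ j * (1 / 2) ^+ (tau <= j)%N.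
have g0 j : 0 <= g j.
  by rewrite /g; apply: mulr_ge0; [apply: mulr_ge0|]; rewrite ?exprn_ge0// divr_ge0.
have sumg : (1 - z) * \sum_j g j <= 1 - z ^+ tau / 2.
  have -> : \sum_j g j = \sum_(j < n.+1 | (1 <= j)%N) z ^+ j -
      (1 / 2) * \sum_(j < n.+1 | (tau <= j)%N && (1 <= j)%N) z ^+ j.
    rewrite mulr_sumr [X in X - _]big_mkcond [X in _ - X]big_mkcond -sumrB.
    apply: eq_bigr => j _; rewrite /g; case: (ltnP 0 j) => _; case: (leqP tau j) => _ /=.
    - by rewrite expr1; lra.
    - by rewrite expr0; lra.
    - by rewrite !mul0r; lra.
    - by rewrite !mul0r; lra.
  rewrite mulrBr sum_expr_tail// expr1.
  have -> : \sum_(j < n.+1 | (tau <= j)%N && (1 <= j)%N) z ^+ j =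
      \sum_(j < n.+1 | (maxn tau 1 <= j)%N) z ^+ j.
    by apply: eq_bigl => j; rewrite geq_max.
  rewrite mulrCA sum_expr_tail; last by rewrite geq_max; lia.
  have : z ^+ tau * z <= z ^+ maxn tau 1.
    case: (tau) => [|t]; first by rewrite max0n expr0 mul1r expr1.
    by rewrite (maxn_idPl _)// -[leRHS]mulr1; apply: ler_wpM2l => //; exact: exprn_ge0.
  have : 0 <= z ^+ n.+1 by exact: exprn_ge0.
  have : z ^+ tau <= 1 by exact: exprn_ile1.
  have : 0 <= (1 - z ^+ tau) * (1 - z).
    by rewrite mulr_ge0 ?subr_ge0//; exact: exprn_ile1.
  nra.
have Pz : P * z ^+ n <= 2 ^+ m * (\sum_j g j) ^+ M.+1.
  rewrite -[M.+1]card_ord -prodr_const bigA_distr_bigA/= mulr_sumr.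
  apply: (@le_trans _ _ (_ * z ^+ n)); first by apply: ler_wpM2r PE; exact: exprn_ge0.
  rewrite mulr_suml; apply: ler_sum => w _.
  set b := [&& _, _ & _]; have [/and3P[few /forallP wpos sw]|_] := boolP b; last first.
    by rewrite mul0r mulr_ge0 ?exprn_ge0// prodr_ge0.
  rewrite mul1r /g !big_split/= big1 ?mul1r; last by move=> v _; rewrite wpos.
  rewrite !prodrXr.
  set h := (\sum_v (tau <= w v)%N)%N.
  have hm : (h <= m)%N.
    rewrite /h ltnW// (leq_trans _ few)// ltnS -sum1dep_card [leqRHS]big_mkcond.
    by apply: leq_sum => v _; rewrite valK; case: (tau <= w v)%N.
  have -> : 2 ^+ m = 2 ^+ (m - h) * 2 ^+ h :> R by rewrite -exprD subnK.
  have zz : z ^+ n <= z ^+ (\sum_v w v)%N.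
    by rewrite ler_wiXn2l.
  rewrite (@le_trans _ _ (z ^+ (\sum_v w v)%N))//.
  rewrite mulrACA -!mulrA -exprMn mulfV ?pnatr_eq0// expr1n mulr1 mulrC ler_peMr ?exprn_ge0//.
  by rewrite exprn_ege1// ler1n.
apply: (@le_trans _ _ (2 ^+ m * (\sum_j g j) ^+ M.+1 * (1 - z) ^+ M.+1)).
  by apply: ler_wpM2r => //; rewrite exprn_ge0// ltW.
rewrite -mulrA -exprMn; apply: ler_wpM2l; first exact: exprn_ge0.
apply: lerXn2r; rewrite ?nnegrE.
- by rewrite mulr_ge0 ?sumr_ge0// ltW.
- by apply: le_trans sumg; rewrite mulr_ge0 ?sumr_ge0// ltW.
- by rewrite mulrC.
Qed.

End Heavy.

(** * Numerical estimates and exponential decay *)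

Section Analysis.
Variable R : realType.

(* A Stirling bound, losing only a factor of order sqrt N; it comes from
   e <= (1 + 1 / k)^(k + 1). *)
Lemma fact_expR_le N : (0 < N)%N ->
  N`!%:R * expR N%:R <= expR 1 * N%:R * N%:R ^+ N :> R.
Proof.
elim: N => // -[|N] IH _; first by rewrite (_ : 1`! = 1)%N// mul1r expr1 !mulr1.
set k := N.+1 in IH *; have k0 : 0 < k%:R :> R by rewrite ltr0n.
have e1 : expR 1 * k%:R ^+ k.+1 <= k.+1%:R ^+ k.+1 :> R.
  have q : expR (- (k.+1%:R^-1)) >= k%:R / k.+1%:R :> R.
    apply: le_trans (expR_ge1Dx _).
    by rewrite -[k.+1%:R]natr1 le_eqVlt; apply/orP/or_introl/eqP; field; rewrite gt_eqF// addr_gt0.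
  have : (k%:R / k.+1%:R) ^+ k.+1 <= expR (- 1) :> R.
    rewrite (_ : -1 = k.+1%:R * - (k.+1%:R^-1)); last by rewrite mulrN mulfV// pnatr_eq0.
    rewrite expRM_natl; apply: lerXn2r => //; rewrite nnegrE ?expR_ge0//.
  rewrite expr_div_n ler_pdivrMr ?exprn_gt0 ?ltr0n// expRN => h.
  by rewrite -ler_pdivlMl ?expR_gt0.
rewrite factS natrM -[X in expR X]natr1 expRD.
rewrite (_ : _ * _ = k.+1%:R * expR 1 * (k`!%:R * expR k%:R)); last by ring.
apply: (@le_trans _ _ (k.+1%:R * expR 1 * (expR 1 * k%:R * k%:R ^+ k))).
  by apply: ler_wpM2l; [rewrite mulr_ge0 ?expR_ge0|exact: IH].
rewrite -[expR 1 * k%:R * _]mulrA -exprS [k.+1%:R * expR 1]mulrC.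
by apply: ler_wpM2l e1; rewrite mulr_ge0 ?expR_ge0.
Qed.

Lemma bernoulli (x : R) N : x <= 1 -> 1 - N%:R * x <= (1 - x) ^+ N.
Proof.
move=> x1; elim: N => [|N IH]; first by rewrite mul0r subr0 expr0.
rewrite exprS -natr1; have x0 : 0 <= 1 - x by lra.
apply: (le_trans _ (ler_wpM2l x0 IH)).
have : 0 <= N%:R * x ^+ 2 by rewrite mulr_ge0// sqr_ge0.
by rewrite expr2; lra.
Qed.

Lemma ler_expn_ffact n N : ((n - N) ^ N <= n ^_ N)%N.
Proof.
elim: N => // N IH; rewrite expnSr ffactnSr leq_mul//; last by lia.
by apply: leq_trans IH; case: (N) => // k; rewrite leq_exp2r// leq_sub2l.
Qed.

(** The value [z = n / (n + N)] maximises [z ^+ n * (1 - z) ^+ N]. Use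
    ['C(n, N) >= (n - N) ^+ N / N!], [z ^+ n >= exp(-N)] and the Stirling bound; by Bernoulli and
    [4 N^2 <= n], replacing [n - N] by [n + N] costs at most a factor 2. *)
Lemma bin_weight_ge n N : (0 < N)%N -> (4 * N * N <= n)%N ->
  (2 * expR 1 * N%:R)^-1 <=
  'C(n, N)%:R * (n%:R / (n + N)%:R) ^+ n * (1 - n%:R / (n + N)%:R) ^+ N :> R.
Proof.
move=> N0 Nn; have Nn' : (N <= n)%N by nia.
have n0 : 0 < n%:R :> R by rewrite ltr0n; lia.
have N0' : 0 < N%:R :> R by rewrite ltr0n.
have nN0 : 0 < (n + N)%:R :> R by rewrite natrD addr_gt0.
have f0 : 0 < N`!%:R :> R by rewrite ltr0n fact_gt0.
have -> : 1 - n%:R / (n + N)%:R = N%:R / (n + N)%:R :> R.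
  by rewrite natrD; field; rewrite -natrD gt_eqF.
have zn : expR (- N%:R) <= (n%:R / (n + N)%:R) ^+ n :> R.
  rewrite (_ : - N%:R = n%:R * - (N%:R / n%:R)); last by field; rewrite gt_eqF.
  rewrite expRM_natl; apply: lerXn2r; rewrite ?nnegrE ?expR_ge0 ?divr_ge0//.
  rewrite expRN -[leRHS]invf_div lef_pV2 ?posrE ?expR_gt0 ?divr_gt0//.
  apply: le_trans (expR_ge1Dx _).
  by rewrite natrD le_eqVlt; apply/orP/or_introl/eqP; field; rewrite gt_eqF.
have Cn : (n%:R - N%:R) ^+ N / N`!%:R <= 'C(n, N)%:R :> R.
  by rewrite ler_pdivrMr// -natrB// -natrX -natrM ler_nat bin_ffact ler_expn_ffact.
have half : 1 / 2 <= ((n%:R - N%:R) / (n + N)%:R) ^+ N :> R.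
  have -> : (n%:R - N%:R) / (n + N)%:R = 1 - 2 * N%:R / (n + N)%:R :> R.
    by rewrite natrD; field; rewrite -natrD gt_eqF.
  have Nn2 : 4 * N%:R * N%:R <= n%:R :> R by rewrite -!natrM ler_nat.
  apply: (le_trans _ (bernoulli _ _)).
    rewrite lerBrDr -lerBrDl mulrA ler_pdivrMr// natrD; nra.
  rewrite ler_pdivrMr// mul1r natrD.
  have : N%:R <= n%:R :> R by rewrite ler_nat.
  lra.
have nN : 0 <= n%:R - N%:R :> R by rewrite subr_ge0 ler_nat.
apply: (@le_trans _ _ ((n%:R - N%:R) ^+ N / N`!%:R * expR (- N%:R) *
    (N%:R / (n + N)%:R) ^+ N)); last first.
  apply: ler_wpM2r; first by rewrite exprn_ge0// divr_ge0.
  by apply: ler_pM => //; rewrite ?expR_ge0// divr_ge0// exprn_ge0.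
have := @fact_expR_le N N0; rewrite expRN => F.
rewrite (_ : _ * _ = ((n%:R - N%:R) / (n + N)%:R) ^+ N *
    (N%:R ^+ N / (N`!%:R * expR N%:R))); last first.
  by rewrite !expr_div_n; field; rewrite !gt_eqF ?expR_gt0// exprn_gt0.
have -> : (2 * expR 1 * N%:R)^-1 = 1 / 2 * (expR 1 * N%:R)^-1 :> R.
  by field; rewrite !gt_eqF ?expR_gt0.
apply: ler_pM; [lra|by rewrite invr_ge0 mulr_ge0 ?expR_ge0|exact: half|].
rewrite ler_pdivlMr ?mulr_gt0 ?expR_gt0// mulrC ler_pdivrMr ?mulr_gt0 ?expR_gt0//.
by rewrite [leRHS]mulrC.
Qed.

(** Under the geometric weights a part is heavy with probability at least [8 / 25], so fewer than a
    fifth of heavy bags is a large deviation. The prefactor is the inverse of the bound of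
    [bin_weight_ge]. *)
Lemma few_heavy_decay n M m tau :
  (5 * m <= M.+1)%N -> (4 * M.+1 * M.+1 <= n)%N ->
  (tau <= n)%N -> (20 * (tau * M.+1) <= 21 * n)%N ->
  expect (fun p : attachments n =>
      (few_heavy M.+1 m tau (bag_size M.+1 (parent p) n))%:R : R) <=
  2 * M.+1%:R * expR (1 - 3 / 100 * M.+1%:R).
Proof.
move=> mM Mn tn tM; set N := M.+1 in mM Mn tM *.
have Nn : (N < n)%N by rewrite /N in Mn *; nia.
have n0 : 0 < n%:R :> R by rewrite ltr0n; lia.
have N0 : 0 < N%:R :> R by rewrite ltr0n.
pose z : R := n%:R / (n + N)%:R.
have nN0 : 0 < (n + N)%:R :> R by rewrite ltr0n; lia.
have z01 : 0 < z < 1.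
  by rewrite /z divr_gt0//= ltr_pdivrMr// mul1r ltr_nat; lia.
have := @few_heavy_bound R n M m tau z (ltnW Nn) tn z01; rewrite -/N.
set P := expect _ => PB.
have P0 : 0 <= P by exact: expect_ge0.
(* Since [tau * N / n <= 21 / 20], the left side is compared with
   [exp(-21/20) >= (1 - 21/200)^10]. *)
have zt : 8 / 25 <= z ^+ tau.
  have zN : expR (- (N%:R / n%:R)) <= z.
    rewrite expRN -[leRHS]invf_div lef_pV2 ?posrE ?expR_gt0 ?divr_gt0//.
    apply: le_trans (expR_ge1Dx _).
    by rewrite natrD le_eqVlt; apply/orP/or_introl/eqP; field; rewrite gt_eqF.
  apply: (@le_trans _ _ (expR (- (N%:R / n%:R)) ^+ tau)); last first.
    by apply: lerXn2r zN; rewrite nnegrE ?expR_ge0// ltW//; case/andP: z01.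
  rewrite -expRM_natl; apply: (@le_trans _ _ (expR (10%:R * - (21 / 200)))).
    rewrite expRM_natl; apply: (@le_trans _ _ ((1 - 21 / 200) ^+ 10)); first by lra.
    by apply: lerXn2r; rewrite ?nnegrE ?expR_ge0 ?expR_ge1Dx//; lra.
  rewrite ler_expR mulrN mulrN lerN2 mulrA ler_pdivrMr//.
  have : 20 * (tau%:R * N%:R) <= 21 * n%:R :> R by rewrite -!natrM ler_nat.
  lra.
have zt1 : z ^+ tau <= 1.
  by rewrite exprn_ile1// ltW//; case/andP: z01.
(* From 1 - z^tau / 2 <= 21/25, 5 m <= N and 2 (21/25)^5 <= (97/100)^5. *)
have m84 : 2 ^+ m * (1 - z ^+ tau / 2) ^+ N <= expR (- (3 / 100 * N%:R)).
  apply: (@le_trans _ _ ((1 - 3 / 100) ^+ N)); last first.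
    rewrite (_ : - (3 / 100 * N%:R) = N%:R * - (3 / 100)); last by rewrite mulrN mulrC.
    by rewrite expRM_natl; apply: lerXn2r; rewrite ?nnegrE ?expR_ge0 ?expR_ge1Dx//; lra.
  apply: (@le_trans _ _ (2 ^+ m * (21 / 25) ^+ N)).
    by apply: ler_wpM2l; [exact: exprn_ge0|apply: lerXn2r; rewrite ?nnegrE; lra].
  have split x : x ^+ N = (x ^+ 5) ^+ m * x ^+ (N - 5 * m) :> R.
    by rewrite -exprM -exprD subnKC.
  rewrite !split mulrA -exprMn.
  apply: ler_pM; [by apply: exprn_ge0; lra|by apply: exprn_ge0; lra| |].
  - by apply: lerXn2r; rewrite ?nnegrE; lra.
  - by apply: lerXn2r; rewrite ?nnegrE; lra.
have W := @bin_weight_ge n N isT Mn.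
have K0 : 0 < 2 * expR 1 * N%:R :> R by rewrite !mulr_gt0 ?expR_gt0.
have := le_trans (le_trans (ler_wpM2l P0 W) PB) m84.
by rewrite ler_pdivrMr// expRD => /le_trans; apply; rewrite le_eqVlt; apply/orP/or_introl/eqP; ring.
Qed.

End Analysis.

(** * Choice of the parameters *)

(** With [tau = K + 1], the roots of heavy bags have branches of size at most [n - (K + 1)], whereas
    each vertex outside the first [l] has one of size at least [n - K]. *)
Lemma most_central_success n (p : attachments n) (s : {perm 'I_n}) N l m K :
  (0 < l)%N -> (0 < N <= n)%N -> (1 < m)%N -> (K < n)%N ->
  ~~ few_heavy N m K.+1 (bag_size N (parent p) n) ->
  ~~ [exists u : 'I_n, (l <= u)%N && (K < bag_size u.+1 (parent p) n u)%N] ->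
  s @^-1: most_central m (relabel s (rec_tree p)) \subset first_vertices n l.
Proof.
move=> l0 /andP[N0 Nn] m1 Kn; rewrite -leqNgt => heavy light.
pose Z := [set v : 'I_n | (v < N)%N && (K < bag_size N (parent p) n v)%N].
have mZ : (m <= #|Z|)%N.
  rewrite (leq_trans heavy)//.
  have wi : injective (widen_ord Nn) by move=> i j /(congr1 val)/= /val_inj.
  rewrite -(card_imset _ wi) subset_leq_card//.
  apply/fintype.subsetP => v /imsetP[v' + ->]; rewrite !inE /= => ->.
  by rewrite ltn_ord.
apply: (most_central_relabel_sub _ mZ) => z y zZ; rewrite inE -leqNgt => ly.
(* As [m >= 2], each heavy bag has a second heavy bag to compare with. *)
have /card_gt0P[z'] : (0 < #|Z :\ z|)%N.
  by move: (cardsD1 z Z) (leq_trans m1 mZ); rewrite zZ add1n => ->.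
rewrite !inE => /andP[z'z /andP[_ z'K]].
move: zZ; rewrite inE => /andP[zN zK].
apply: leq_ltn_trans (max_branch_inner zN z'z zK z'K) _.
apply: leq_trans (max_branch_outer p (leq_trans l0 ly)).
have : (bag_size y.+1 (parent p) n y <= K)%N.
  rewrite leqNgt; apply: contraNN light => yK.
  by apply/existsP; exists y; rewrite ly.
(* [K < n] keeps the comparison strict under truncated subtraction. *)
lia.
Qed.

Lemma limn_einf_ge (R : realType) (u : nat -> \bar R) (c : \bar R) n0 :
  (forall n, (n0 <= n)%N -> (c <= u n)%E) -> (c <= limn_einf u)%E.
Proof.
move=> cu; rewrite limn_einf_lim; apply: lime_ge; first exact: is_cvg_einfs.
exists n0 => // n /= n0n; apply: le_ereal_inf_tmp => _ [k /= nk <-].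
by apply: cu; rewrite (leq_trans n0n).
Qed.

Section Constants.
Variables (R : realType) (eps : R) (l : nat) (a : R).
Hypotheses (heps : 0 < eps < 1) (hl : (1 <= l)%N).
Hypothesis ha : a = 2 * ln (4 * l%:R ^+ 2 / eps) + 1.
Hypothesis hlarge : 64 * a ^+ 2 * ln (22 * a * l%:R ^+ 2 / eps) <= l%:R.

Let L : R := ln (4 * l%:R ^+ 2 / eps).
Let Lam : R := ln (22 * a * l%:R ^+ 2 / eps).

Let l1 : 1 <= l%:R :> R. Proof. by rewrite ler1n. Qed.

Let l0 : 0 < l%:R :> R. Proof. by rewrite ltr0n. Qed.

Let l_sq : l%:R <= l%:R ^+ 2 :> R.
Proof. by rewrite expr2 ler_peMr. Qed.

Let e0 : 0 < eps. Proof. by case/andP: heps. Qed.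

Let ratio_ge1 : 1 <= l%:R ^+ 2 / eps.
Proof.
rewrite ler_pdivlMr// mul1r (le_trans (ltW (andP heps).2))//.
exact: exprn_ege1.
Qed.

Let ratio_gt0 : 0 < l%:R ^+ 2 / eps.
Proof. exact: lt_le_trans ratio_ge1. Qed.

Lemma expR_L : expR L = 4 * l%:R ^+ 2 / eps.
Proof. by rewrite /L lnK// posrE -mulrA mulr_gt0// (lt_le_trans _ ratio_ge1). Qed.

Lemma L_ge1 : 1 <= L.
Proof.
rewrite -ler_expR expR_L -mulrA (@le_trans _ _ 4)//; last by rewrite ler_peMr.
have : (1 / 2) ^+ 2 <= expR (- 1) :> R.
  rewrite (_ : -1 = 2%:R * - (1 / 2)); last by lra.
  rewrite expRM_natl; apply: lerXn2r; rewrite ?nnegrE; [lra|exact: expR_ge0|].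
  by apply: le_trans (expR_ge1Dx _); lra.
by rewrite expRN -[(expR 1)^-1]mul1r ler_pdivlMr ?expR_gt0//; lra.
Qed.

Lemma aE : a = 2 * L + 1. Proof. by []. Qed.

Lemma expR_Lam : expR Lam = 22 * a * (l%:R ^+ 2 / eps).
Proof.
have a0 : 0 < a by rewrite aE; have := L_ge1; lra.
rewrite /Lam -mulrA lnK// posrE; apply: mulr_gt0 => //; exact: mulr_gt0.
Qed.

Lemma Lam_ge1 : 1 <= Lam.
Proof.
apply: le_trans L_ge1 _; rewrite -ler_expR expR_L expR_Lam -[4 * _ / _]mulrA.
apply: ler_wpM2r; first exact: ltW.
by rewrite aE; have := L_ge1; lra.
Qed.

(** Divide [hlarge] by [L] and use [a >= 2 * L]. *)
Lemma l_over_L : 128 * a * Lam <= l%:R / L.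
Proof.
have := L_ge1; have := Lam_ge1 => Lm LL.
rewrite ler_pdivlMr; last by lra.
apply: le_trans hlarge; rewrite -/Lam.
have a0 : 0 < a by rewrite aE; lra.
have : 0 <= a * Lam by rewrite mulr_ge0//; lra.
have -> : L = (a - 1) / 2 by rewrite aE; lra.
rewrite expr2; lra.
Qed.

(** The exponent is at most [- Lam] because [N >= 384 * Lam - 1], and [exp(-Lam) = eps / (22 a l^2)]
    absorbs the factor [2 * N <= 2 * l]. *)
Lemma few_heavy_small N : (0 < N)%N -> (N <= l)%N -> l%:R / L - 1 <= N%:R ->
  2 * N%:R * expR (1 - 3 / 100 * N%:R) <= eps / 2.
Proof.
move=> N0 Nl lN; have := l_over_L; have := Lam_ge1; have := L_ge1 => L1 Lam1 lL.
have a3 : 3 <= a by rewrite aE; lra.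
have aL : 3 * Lam <= a * Lam by apply: ler_wpM2r => //; lra.
have expo : 1 - 3 / 100 * N%:R <= - Lam by lra.
have Nl' : N%:R <= l%:R :> R by rewrite ler_nat.
apply: (@le_trans _ _ (2 * l%:R * expR (- Lam))).
  by apply: ler_pM; rewrite ?expR_ge0 ?ler_expR//; nra.
rewrite expRN expR_Lam ler_pdivrMr; last by rewrite -expR_Lam expR_gt0.
rewrite (_ : eps / 2 * _ = 11 * a * l%:R ^+ 2); last by field; rewrite gt_eqF.
have := l_sq; nra.
Qed.

(** The ratio is at most [exp(-L / l)], so its power is at most [exp(-L) = eps / (4 l^2)]; the other
    factor is at most [l / L <= l]. *)
Lemma light_small n K : (K < n)%N -> L / l%:R * n%:R <= K%:R ->
  ((n.-1 - K)%:R / n.-1%:R) ^+ l * (n.-1%:R / K%:R) <= eps / 2.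
Proof.
move=> Kn tK; have := L_ge1 => L1.
have L0 : 0 < L by lra.
have t0 : 0 < L / l%:R by exact: divr_gt0.
have n0 : 0 < n%:R :> R by rewrite ltr0n (leq_ltn_trans _ Kn).
have K0 : 0 < K%:R :> R by rewrite (lt_le_trans _ tK)// mulr_gt0.
have Kn' : (K <= n.-1)%N by rewrite -ltnS prednK// (leq_ltn_trans _ Kn).
have n1 : 0 < n.-1%:R :> R by rewrite (lt_le_trans K0)// ler_nat.
have nn : n.-1%:R <= n%:R :> R by rewrite ler_nat leq_pred.
have tn : L / l%:R <= K%:R / n.-1%:R.
  by rewrite ler_pdivlMr//; apply: le_trans tK; apply: ler_wpM2l; lra.
have q : (n.-1 - K)%:R / n.-1%:R <= expR (- (L / l%:R)).
  apply: le_trans (expR_ge1Dx _); rewrite natrB//.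
  by rewrite mulrBl mulfV ?gt_eqF//; lra.
apply: (@le_trans _ _ (expR (- L) * l%:R)); last first.
  rewrite expRN expR_L ler_pdivrMl; last by rewrite -expR_L expR_gt0.
  rewrite (_ : _ * (eps / 2) = 2 * l%:R ^+ 2); last by field; rewrite gt_eqF.
  by rewrite (le_trans l_sq)// ler_peMl ?exprn_ge0//; lra.
apply: ler_pM; rewrite ?exprn_ge0 ?divr_ge0//.
  rewrite (_ : - L = l%:R * - (L / l%:R)); last first.
    by rewrite mulrN mulrC divfK// gt_eqF.
  by rewrite expRM_natl; apply: lerXn2r; rewrite ?nnegrE ?expR_ge0 ?divr_ge0.
rewrite -invf_div; apply: (@le_trans _ _ (L / l%:R)^-1).
  by rewrite lef_pV2 ?posrE ?divr_gt0.
by rewrite invf_div ler_pdivrMr// ler_peMr.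
Qed.

(** The successor puts [m] above [l / (3 a)]. As [l / (3 a) <= l / (6 L)], rounding still leaves
    [5 * m <= N]. *)
Let N := Num.truncn (l%:R / L).
Let m := (Num.truncn (l%:R / (3 * a))).+1.

Let a_ge3 : 3 <= a. Proof. by rewrite aE; have := L_ge1; lra. Qed.

Let L_gt0 : 0 < L. Proof. exact: lt_le_trans L_ge1. Qed.

Let l_over_L_ge : 384 <= l%:R / L.
Proof.
apply: le_trans l_over_L; rewrite -mulrA.
have : 3 * 1 <= a * Lam by apply: ler_pM => //; exact: Lam_ge1.
lra.
Qed.

Let N_le : N%:R <= l%:R / L.
Proof. by rewrite truncn_le; have := l_over_L_ge; lra. Qed.

Let N_ge : l%:R / L - 1 <= N%:R.
Proof. by rewrite lerBlDr natr1 ltW// truncnS_gt. Qed.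

Let N_gt0 : (0 < N)%N.
Proof. by rewrite -(ltr0n R); have := l_over_L_ge; have := N_ge; lra. Qed.

Let N_le_l : (N <= l)%N.
Proof.
rewrite -(ler_nat R) (le_trans N_le)// ler_pdivrMr// ler_peMr//; exact: L_ge1.
Qed.

Lemma seed_size_gt1 : (1 < m)%N.
Proof.
rewrite ltnS truncn_gt0 ler_pdivlMr ?mulr_gt0 ?mul1r//; last exact: lt_le_trans a_ge3.
apply: le_trans hlarge; rewrite -/Lam expr2.
have a3 := a_ge3; have : a * 1 <= a * Lam by apply: ler_wpM2l; [lra|exact: Lam_ge1].
by nra.
Qed.

Lemma seed_size_le : (5 * m <= N)%N.
Proof.
rewrite -ltnS -(ltr_nat R) natrM /m -[(Num.truncn _).+1%:R]natr1 -[N.+1%:R]natr1.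
have a0 : 0 < a by have := a_ge3; lra.
have h : l%:R / (3 * a) <= (l%:R / L) / 6.
  rewrite -mulrA -invfM ler_pM2l// lef_pV2 ?posrE ?mulr_gt0//.
  by rewrite aE; lra.
have t : (Num.truncn (l%:R / (3 * a)))%:R <= l%:R / (3 * a).
  by rewrite truncn_le divr_ge0// mulr_ge0// ltW.
by have := N_ge; have := l_over_L_ge; lra.
Qed.

Lemma seed_found n : (40 * N * N <= n)%N ->
  1 - eps <= Pr (seed_law (central_algorithm R m) n)
               (fun w => seed_set w \subset first_vertices n l).
Proof.
move=> Nn; have N0 := N_gt0; have m1 := seed_size_gt1; have mN := seed_size_le.
have nR : 40 * N%:R * N%:R <= n%:R :> R by rewrite -!natrM ler_nat.
have N1 : 1 <= N%:R :> R by rewrite ler1n.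
have NnR : 40 * N%:R <= n%:R :> R.
  by apply: le_trans nR; rewrite ler_peMr//; lra.
have n40 : 40 <= n%:R :> R by lra.
pose T := Num.truncn (L / l%:R * n%:R); pose K := T.+1.
have tn0 : 0 <= L / l%:R * n%:R by rewrite !mulr_ge0 ?invr_ge0// ltW.
have T_le : T%:R <= L / l%:R * n%:R by rewrite truncn_le.
have K_gt : L / l%:R * n%:R <= K%:R by rewrite ltW// truncnS_gt.
have Ll : L / l%:R <= 1 / 384.
  by have := l_over_L_ge; rewrite ler_pdivlMr// ler_pdivrMr//; lra.
have Kn : (K.+1 <= n)%N.
  rewrite -(ler_nat R) /K -!natr1.
  have : L / l%:R * n%:R <= 1 / 384 * n%:R by apply: ler_wpM2r.
  lra.
(* Here [K.+1 = T + 2]: the main part [T * N] is at most [n], and the rounding [2 * N] is at most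
   [n / 20]. *)
have KN : (20 * (K.+1 * N) <= 21 * n)%N.
  rewrite -(ler_nat R) !natrM /K -!natr1.
  have : T%:R * N%:R <= n%:R :> R.
    apply: (le_trans (ler_pM _ _ T_le N_le)) => //.
    by rewrite le_eqVlt; apply/orP/or_introl/eqP; field; rewrite !gt_eqF.
  lra.
pose good (p : attachments n) := ~~ few_heavy N m K.+1 (bag_size N (parent p) n) &&
  ~~ [exists u : 'I_n, (l <= u)%N && (K < bag_size u.+1 (parent p) n u)%N].
have Nn' : (N <= n)%N by rewrite -(ler_nat R); lra.
apply: (@le_trans _ _ (Pr (attach_law R n) good)); last first.
  apply: Pr_central_algorithm => p s /andP[few light].
  by apply: most_central_success few light => //; rewrite N0.
rewrite Pr_expect; have l0' : (0 < l)%N by exact: hl.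
have tail := le_trans (@expect_exists_bag_tail R n l K l0' Kn) (light_small Kn K_gt).
have few : expect (fun p : attachments n =>
    (few_heavy N m K.+1 (bag_size N (parent p) n))%:R : R) <= eps / 2.
  apply: le_trans _ (few_heavy_small N0 N_le_l N_ge); rewrite -(prednK N0).
  apply: few_heavy_decay; rewrite ?prednK//.
  by apply: leq_trans Nn; rewrite !leq_mul.
(* Each attachment sequence is good, has few heavy bags, or has a late vertex with more than [K]
   descendants. *)
have sum1 : 1 <= expect (fun p => (good p)%:R) + expect (fun p : attachments n =>
    (few_heavy N m K.+1 (bag_size N (parent p) n))%:R : R) +
   expect (fun p : attachments n =>
    [exists u : 'I_n, (l <= u)%N && (K < bag_size u.+1 (parent p) n u)%N]%:R : R).
  rewrite -!expectD -[leLHS](expect_cst n (1 : R)); apply: le_expect => p.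
  by rewrite /good; case: few_heavy; case: [exists _, _] => /=; lra.
lra.
Qed.

Lemma card_seed_found n (w : outcome n) : (l <= n)%N ->
  0 < seed_law (central_algorithm R m) n w -> l%:R / (3 * a) <= #|seed_set w|%:R.
Proof.
move=> ln w0; rewrite (card_seed_set_central _ w0) ?ltW ?truncnS_gt//.
apply: leq_trans ln; apply: leq_trans N_le_l; apply: leq_trans seed_size_le.
exact: leq_pmull.
Qed.

End Constants.

Unset Implicit Arguments.

Theorem theorem5 (R : realType) (eps : R) (l : nat) (a : R)
  (heps : 0 < eps < 1)
  (hl : (1 <= l)%N)
  (ha : a = 2 * ln (4 * l%:R ^+ 2 / eps) + 1)
  (hlarge : 64 * a ^+ 2 * ln (22 * a * l%:R ^+ 2 / eps) <= l%:R) :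
  exists A : seed_algorithm R,
    (forall n : nat, (l <= n)%N ->
       forall w : outcome n, 0 < seed_law A n w ->
         l%:R / (3 * a) <= #|seed_set w|%:R) /\
    ((1 - eps)%:E <=
       limn_einf (fun n : nat =>
         (Pr (seed_law A n)
            (fun w => seed_set w \subset first_vertices n l))%:E))%E.
Proof.
exists (central_algorithm R (Num.truncn (l%:R / (3 * a))).+1).
split=> [n ln w|].
  exact: (card_seed_found heps hl ha hlarge ln).
set L := ln (4 * l%:R ^+ 2 / eps).
pose N := Num.truncn (l%:R / L).
apply: (@limn_einf_ge _ _ _ (40 * N * N)) => n Nn; rewrite lee_fin.
exact: (seed_found heps hl ha hlarge Nn).
Qed.
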